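(* Let $G$ be a nontrivial compact second countable (Hausdorff) topological group with Haar measure $m_G$, and for every $i\ge1$ let $M_i=G$ with the global left action $g.p=gp$. Then $(M_i)_{i\ge1}$ is a sofic approximation to $G$. For every $\alpha>0$, the Poisson action $G\curvearrowright(\mathcal N(G),\mu_\alpha)$, where $\mu_\alpha$ is the law of the Poisson point process on $G$ with intensity $\alpha m_G$ and $(g\omega)(A)=\omega(Ag)$, does not have completely positive measure sofic entropy with respect to this sofic approximation.
   Context: **Local $G$-spaces and sofic approximations.** Let $G$ be a locally compact second countable group with identity $e$ and a fixed right Haar measure $m_G$. A local left $G$-space is a locally compact second countable Hausdorff space $M$ with a continuous map $\vartheta:\mathrm{dom}(\vartheta)\to M$, written $\vartheta(g,p)=g.p$, with $\mathrm{dom}(\vartheta)\subseteq G\times M$ open, such that for every $p\in M$: (1) $(e,p)\in\mathrm{dom}(\vartheta)$ and $e.p=p$; (2) if $(g,p)\in\mathrm{dom}(\vartheta)$ then $(g^{-1},g.p)\in\mathrm{dom}(\vartheta)$ and $g^{-1}.(g.p)=p$; (3) if $(h,p),(g,h.p),(gh,p)\in\mathrm{dom}(\vartheta)$ then $(gh).p=g.(h.p)$; (4) there is an open neighborhood $V_p$ of $e$ with $V_p\times\{p\}\subseteq\mathrm{dom}(\vartheta)$ such that $g\mapsto g.p$ is a homeomorphism from $V_p$ onto an open neighborhood of $p$. A chart centered at $p$ is a homeomorphism $f_p$ from an open neighborhood $\mathrm{dom}(f_p)$ of $p$ onto an open neighborhood $\mathrm{rng}(f_p)$ of $e$ with $f_p(g.p)=g$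 for all $g\in\mathrm{rng}(f_p)$. The canonical measure $\mathrm{vol}_M$ is the unique Radon measure on $M$ with $\mathrm{vol}_M(E)=m_G(f_p(E))$ for every chart $f_p$ and every Borel $E\subseteq\mathrm{dom}(f_p)$. For precompact open $U\subseteq G$, $M[U]$ is the set of $p\in M$ such that (i) if $g,h,gh\in U$ then $g.(h.p)=(gh).p$ with both sides defined, and (ii) $g\mapsto g.p$ is a homeomorphism from $U$ onto an open neighborhood of $p$. $M$ is a $(U,\varepsilon)$-sofic approximation if $0<\mathrm{vol}_M(M)<\infty$ and $\mathrm{vol}_M(M[U])\ge(1-\varepsilon)\mathrm{vol}_M(M)$. A sofic approximation to $G$ is a sequence $\Sigma=(M_i)_{i\ge1}$ with $M_i$ a $(U_i,\varepsilon_i)$-sofic approximation, where the $U_i$ are precompact open, $U_1\subseteq U_2\subseteq\cdots$, $\bigcup_iU_i=G$, and $\varepsilon_i\to0$. **Poisson action.** $\mathcal N(G)$ is the space of locally finite integer-valued (nonnegative) Radon measures on $G$ with the vague topology and its Borel $\sigma$-algebra. The Poisson point process with intensity $\alpha m_G$ is the random element $\eta$ of $\mathcal N(G)$ such that, for pairwise disjoint Borel sets $A_1,\dots,A_k$ of finite Haar measure, $\eta(A_1),\dots,\eta(A_k)$ are independent with $\eta(A_j)\sim\mathrm{Pois}(\alpha m_G(A_j))$. **Actions, factors, models.** A standard pmp action is a Borel action of $G$ on a standard probability space preserving the measure. A measurable factor map $\pi:(X,\mu)\to(Z,\zeta)$ of standard pmp actions is a measurable map with $\pi_*\mu=\zeta$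 and, for every $g\in G$, $\pi(gx)=g\pi(x)$ for $\mu$-a.e. $x$. The factor is nontrivial if $\zeta$ is not a point mass. A measure conjugacy is a factor map that restricts to an equivariant Borel bijection with Borel inverse between invariant conull Borel sets. A compact model of $(Z,\zeta)$ is a compact metrizable space $Y$ with a jointly continuous $G$-action, an invariant Borel probability measure $\nu$, and a measure conjugacy between $(Z,\zeta)$ and $(Y,\nu)$. **Entropy.** Let $(Y,\nu)$ be a compact model and $\rho\le1$ a compatible metric on $Y$. For a finite-volume local $G$-space $M$ put $\overline{\mathrm{vol}}_M=\mathrm{vol}_M/\mathrm{vol}_M(M)$, $M[g]=\{p\in M:(g,p)\in\mathrm{dom}(\vartheta)\}$, $\rho^M(\psi,\psi')=\int_M\rho(\psi(p),\psi'(p))\,d\overline{\mathrm{vol}}_M(p)$ for measurable $\psi,\psi':M\to Y$, and $$\Delta_{\rho,M}(g,\psi)=\int_{M[g]}\rho(\psi(g.p),g\psi(p))\,d\overline{\mathrm{vol}}_M(p)+\overline{\mathrm{vol}}_M(M\setminus M[g]).$$ For a precompact open neighborhood $L$ of $e$, $\delta>0$ and a weak-star neighborhood $\mathcal O$ of $\nu$ in $\mathrm{Prob}(Y)$, $\mathrm{Map}(M,Y,\rho:L,\delta,\mathcal O)$ is the set of measurable $\psi:M\to Y$ with $\Delta_{\rho,M}(g,\psi)<\delta$ for all $g\in L$ and $\psi_*\overline{\mathrm{vol}}_M\in\mathcal O$. $\mathrm{Sep}_\varepsilon(E,\rho^M)$ is the maximal cardinality of a subset of $E$ whose distinct elements are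 at $\rho^M$-distance $>\varepsilon$ ($\mathrm{Sep}_\varepsilon(\varnothing)=0$, $\log0=-\infty$, $\log\infty=\infty$). With $V_i=\mathrm{vol}_{M_i}(M_i)$, $$h^{\mathrm{meas}}_{\Sigma,\varepsilon}(G,Y,\nu,\rho)=\inf_{\mathcal O}\inf_L\inf_{\delta>0}\limsup_{i\to\infty}\frac1{V_i}\log\mathrm{Sep}_\varepsilon\bigl(\mathrm{Map}(M_i,Y,\rho:L,\delta,\mathcal O),\rho^{M_i}\bigr),$$ $$h^{\mathrm{meas}}_\Sigma(G,Y,\nu,\rho)=\lim_{\varepsilon\downarrow0}h^{\mathrm{meas}}_{\Sigma,\varepsilon}(G,Y,\nu,\rho).$$ **Completely positive entropy.** A standard pmp action has completely positive measure sofic entropy relative to $\Sigma$ if for every nontrivial measurable factor $(Z,\zeta)$, every compact model $(Y,\nu)$ of $(Z,\zeta)$ and every compatible metric $\rho\le1$ on $Y$, $h^{\mathrm{meas}}_\Sigma(G,Y,\nu,\rho)>0$ (the value is regarded as independent of the model and metric). *)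

(* Defs.v *)
From HB Require Import structures.
From mathcomp Require Export all_boot all_order all_algebra.
From mathcomp Require Export all_classical all_reals all_analysis.
From mathcomp Require Export measurable_realfun.

Set Implicit Arguments.
Unset Strict Implicit.
Unset Printing Implicit Defensive.

Export Order.TTheory GRing.Theory Num.Theory.
Export numFieldNormedType.Exports.

Local Open Scope classical_set_scope.
Local Open Scope ring_scope.

(* Measurable types are pointed in the library, hence so are all the spaces
   below; the distinguished point plays no role. *)
Notation borel T := (g_sigma_algebraType (@open T)).

Definition lcsc_hausdorff (T : topologicalType) : Prop :=
  [/\ hausdorff_space T, @second_countable T & locally_compact [set: T]].

HB.mixin Record isLcscGroup G & PointedTopological G & Group G := {
  mulg_continuous : continuous (fun x : G * G => (x.1 * x.2)%g);
  invg_continuous : continuous (fun x : G => (x^-1)%g);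
  lcscG : lcsc_hausdorff G }.

#[short(type="lcscGroupType")]
HB.structure Definition LcscGroup :=
  {G of PointedTopological G & Group G & isLcscGroup G}.

(* f restricts to a homeomorphism from A onto B (subspace topologies). *)
Definition homeo_on (S T : topologicalType) (A : set S) (B : set T)
    (f : S -> T) : Prop :=
  [/\ set_bij A B f, {within A, continuous f} &
      exists2 f' : T -> S, (forall x, A x -> f' (f x) = x) &
        {within B, continuous f'}].

Section Radon.
Context {R : realType} {T : ptopologicalType}.
Local Open Scope ereal_scope.

Definition radon (mu : {measure set (borel T) -> \bar R}) : Prop :=
  [/\ forall K : set T, compact K -> mu K < +oo,
      forall A : set (borel T), measurable A ->
        mu A = ereal_inf [set mu U | U in [set U : set T | open U /\ A `<=` U]] &
      forall U : set T, open U ->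
        mu U = ereal_sup [set mu K | K in [set K : set T | compact K /\ K `<=` U]]].

End Radon.

Definition right_haar {R : realType} {G : lcscGroupType}
    (m : {measure set (borel G) -> \bar R}) : Prop :=
  [/\ radon m, m [set: G] != 0%E &
      forall (g : G) (A : set (borel G)), measurable A ->
        m [set (x * g)%g | x in A] = m A].

(* The partial map of a local G-space is represented by a total function [act]
   together with the open set [act_dom] on which its values are meaningful. *)
Record local_space (G : lcscGroupType) := LocalSpace {
  carrier :> ptopologicalType;
  act_dom : set (G * carrier);
  act : G -> carrier -> carrier;
  lcscM : lcsc_hausdorff carrier;
  act_dom_open : open act_dom;
  act_continuous : {within act_dom, continuous (fun x => act x.1 x.2)};
  act1 : forall p, act_dom (1%g, p) /\ act 1%g p = p;
  actV : forall g p, act_dom (g, p) ->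
    act_dom (g^-1%g, act g p) /\ act g^-1%g (act g p) = p;
  actM : forall g h p, act_dom (h, p) -> act_dom (g, act h p) ->
    act_dom ((g * h)%g, p) -> act (g * h)%g p = act g (act h p);
  act_homeo : forall p, exists V : set G,
    [/\ open_nbhs 1%g V, (forall g, V g -> act_dom (g, p)) &
        exists2 W : set carrier, open_nbhs p W & homeo_on V W (act^~ p)] }.

Arguments act_dom {G} _ _.
Arguments act {G} _ _ _.

Section Translation.
Variable G : lcscGroupType.

Local Lemma cst_mul_cts (h : G) : continuous (fun g : G => (g * h)%g).
Proof.
move=> g; apply: (@continuous_comp _ _ _ (fun g => (g, h)) (fun x => (x.1 * x.2)%g)).
  by apply: cvg_pair; [exact: cvg_id | exact: cvg_cst].
exact: mulg_continuous.
Qed.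

Local Lemma translation_homeo (p : G) : exists V : set G,
  [/\ open_nbhs 1%g V, (forall g, V g -> [set: G * G] (g, p)) &
      exists2 W : set G, open_nbhs p W & homeo_on V W (fun g => (g * p)%g)].
Proof.
exists setT; split => //; first by split => //; exact: openT.
exists setT; first by split => //; exact: openT.
split.
- split => //; first by move=> x y _ _ /mulIg.
  by move=> x _; exists (x * p^-1)%g => //; rewrite mulgVK.
- by apply: continuous_subspaceT; exact: cst_mul_cts.
- exists (fun x => (x * p^-1)%g); first by move=> x _; rewrite mulgK.
  by apply: continuous_subspaceT; exact: cst_mul_cts.
Qed.

Local Lemma translation_cts :
  {within [set: G * G], continuous (fun x => (x.1 * x.2)%g)}.
Proof. by apply: continuous_subspaceT; exact: mulg_continuous. Qed.

Local Lemma translation1 (p : G) : [set: G * G] (1%g, p) /\ (1 * p)%g = p.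
Proof. by rewrite mul1g. Qed.

Local Lemma translationV (g p : G) : [set: G * G] (g, p) ->
  [set: G * G] (g^-1%g, (g * p)%g) /\ (g^-1 * (g * p))%g = p.
Proof. by rewrite mulKg. Qed.

Local Lemma translationM (g h p : G) : [set: G * G] (h, p) ->
  [set: G * G] (g, (h * p)%g) -> [set: G * G] ((g * h)%g, p) ->
  (g * h * p)%g = (g * (h * p))%g.
Proof. by rewrite mulgA. Qed.

(* G with its global left action on itself. *)
Definition translation_space : local_space G :=
  @LocalSpace G G setT (fun g p => (g * p)%g) (lcscG (s := G)) openT
    translation_cts translation1 translationV translationM translation_homeo.

End Translation.

Section LocalSpaces.
Context {R : realType} {G : lcscGroupType}.
Variable m : {measure set (borel G) -> \bar R}.
Implicit Types M : local_space G.

(* f is a chart centered at p with domain D and range V. *)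
Definition is_chart M (p : M) (D : set M) (V : set G) (f : M -> G) : Prop :=
  [/\ open_nbhs p D, open_nbhs 1%g V, homeo_on D V f &
      forall g, V g ->
        [/\ act_dom M (g, p), D (act M g p) & f (act M g p) = g]].

Definition is_vol M (mu : {measure set (borel M) -> \bar R}) : Prop :=
  radon mu /\
  forall p D V f, @is_chart M p D V f ->
    forall E : set (borel M), measurable E -> E `<=` D -> mu E = m (f @` E).

(* The canonical measure: existence and uniqueness (on Borel sets) hold when m
   is a right Haar measure. *)
Definition vol M : {measure set (borel M) -> \bar R} :=
  if pselect (exists mu, @is_vol M mu) is left e then projT1 (cid e)
  else mzero.

Definition good_points M (U : set G) : set M :=
  [set p |
    (forall g h, U g -> U h -> U (g * h)%g ->
       [/\ act_dom M (h, p), act_dom M (g, act M h p), act_dom M ((g * h)%g, p) &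
           act M g (act M h p) = act M (g * h)%g p]) /\
    (forall g, U g -> act_dom M (g, p)) /\
    exists2 W : set M, open_nbhs p W & homeo_on U W (act M ^~ p)].

Definition sofic_approx_space (U : set G) (eps : R) M : Prop :=
  [/\ (0 < vol M setT)%E, (vol M setT < +oo)%E &
      ((1 - eps)%:E * vol M setT <= vol M (@good_points M U))%E].

Definition sofic_approximation (Sigma : nat -> local_space G) : Prop :=
  exists (U : nat -> set G) (eps : nat -> R),
    [/\ forall i, open (U i) /\ precompact (U i),
        forall i, U i `<=` U i.+1,
        \bigcup_i U i = setT,
        eps @ \oo --> 0 &
        forall i, sofic_approx_space (U i) (eps i) (Sigma i)].

Local Lemma inv_vol_ge0 M : 0 <= (fine (vol M setT))^-1.
Proof. by rewrite invr_ge0 fine_ge0. Qed.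

Definition nvol M : {measure set (borel M) -> \bar R} :=
  mscale (NngNum (inv_vol_ge0 M)) (vol M).

End LocalSpaces.

Section Metrics.
Context {R : realType}.

Definition is_metric (T : Type) (rho : T -> T -> R) : Prop :=
  [/\ forall x y, 0 <= rho x y,
      forall x y, rho x y = 0 <-> x = y,
      forall x y, rho x y = rho y x &
      forall x y z, rho x z <= rho x y + rho y z].

Definition compatible_metric (T : topologicalType) (rho : T -> T -> R) : Prop :=
  is_metric rho /\
  forall (x : T) (A : set T),
    nbhs x A <-> exists2 e, 0 < e & [set y | rho x y < e] `<=` A.

Definition metric_open (T : Type) (rho : T -> T -> R) : set (set T) :=
  [set A | forall x, A x -> exists2 e, 0 < e & [set y | rho x y < e] `<=` A].

Definition metric_separable (T : Type) (rho : T -> T -> R) : Prop :=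
  exists2 D : set T, countable D &
    forall x e, 0 < e -> exists2 y, D y & rho x y < e.

Definition metric_complete (T : Type) (rho : T -> T -> R) : Prop :=
  forall u : nat -> T,
    (forall e, 0 < e -> exists N, forall i j, (N <= i)%N -> (N <= j)%N ->
       rho (u i) (u j) < e) ->
    exists l, forall e, 0 < e -> exists N, forall i, (N <= i)%N ->
      rho (u i) l < e.

(* The sigma-algebra of X is the Borel sigma-algebra of a Polish topology. *)
Definition standard_borel d (X : measurableType d) : Prop :=
  exists rho : X -> X -> R,
    [/\ is_metric rho, metric_separable rho, metric_complete rho &
        (measurable : set (set X)) = <<s metric_open rho >>].

End Metrics.

Section Actions.
Context {R : realType} {G : lcscGroupType}.

Definition is_action (X : Type) (a : G -> X -> X) : Prop :=
  (forall x, a 1%g x = x) /\ (forall g h x, a (g * h)%g x = a g (a h x)).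

Definition preserves d (X : measurableType d) (a : G -> X -> X)
    (mu : probability X R) : Prop :=
  forall g (A : set X), measurable A -> mu (a g @^-1` A) = mu A.

Definition standard_pmp_action d (X : measurableType d) (a : G -> X -> X)
    (mu : probability X R) : Prop :=
  [/\ @standard_borel R d X, is_action a,
      measurable_fun setT (fun x : borel G * X => a x.1 x.2) &
      preserves a mu].

Definition factor_map dX (X : measurableType dX) (a : G -> X -> X)
    (mu : probability X R) dZ (Z : measurableType dZ) (b : G -> Z -> Z)
    (zeta : probability Z R) (pi : X -> Z) : Prop :=
  [/\ measurable_fun setT pi,
      forall A : set Z, measurable A -> mu (pi @^-1` A) = zeta A &
      forall g, {ae mu, forall x, pi (a g x) = b g (pi x)}].

Definition point_mass d (Z : measurableType d) (zeta : probability Z R) : Prop :=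
  exists z : Z, forall A : set Z, measurable A -> zeta A = \d_z A.

Definition invariant_conull d (X : measurableType d) (a : G -> X -> X)
    (mu : probability X R) (X0 : set X) : Prop :=
  [/\ measurable X0, mu (~` X0) = 0%E & forall g x, X0 x -> X0 (a g x)].

Definition measure_conjugacy dX (X : measurableType dX) (a : G -> X -> X)
    (mu : probability X R) dZ (Z : measurableType dZ) (b : G -> Z -> Z)
    (zeta : probability Z R) (pi : X -> Z) : Prop :=
  factor_map a mu b zeta pi /\
  exists (X0 : set X) (Z0 : set Z),
    [/\ invariant_conull a mu X0, invariant_conull b zeta Z0,
        set_bij X0 Z0 pi,
        forall g x, X0 x -> pi (a g x) = b g (pi x) &
        exists2 pi' : Z -> X, (forall x, X0 x -> pi' (pi x) = x) &
          measurable_fun Z0 pi'].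

Definition compact_model dZ (Z : measurableType dZ) (b : G -> Z -> Z)
    (zeta : probability Z R) (Y : ptopologicalType) (c : G -> Y -> Y)
    (nu : probability (borel Y) R) : Prop :=
  [/\ compact [set: Y] /\ (exists rho : Y -> Y -> R, compatible_metric rho),
      is_action c,
      continuous (fun x : G * Y => c x.1 x.2),
      preserves (X := borel Y) c nu &
      exists phi : Z -> borel Y,
        measure_conjugacy (Z := borel Y) b zeta c nu phi].

End Actions.

Section WeakStar.
Context {R : realType} (Y : ptopologicalType).

Definition weak_star_eval (P : probability (borel Y) R) :
    {ptws {f : Y -> R | continuous f} -> R} :=
  fun f => (\int[P]_y (sval f y))%R.

(* Prob(Y) with the weak-star topology. *)
Definition weak_star : topologicalType := initial_topology weak_star_eval.

End WeakStar.

Section Entropy.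
Context {R : realType} {G : lcscGroupType}.
Variable m : {measure set (borel G) -> \bar R}.
Variable Sigma : nat -> local_space G.
Context {Y : ptopologicalType}.
Variables (c : G -> Y -> Y) (nu : probability (borel Y) R) (rho : Y -> Y -> R).
Implicit Types M : local_space G.
Local Open Scope ereal_scope.

Definition map_dist M (psi psi' : M -> Y) : \bar R :=
  \int[nvol m M]_p (rho (psi p) (psi' p))%:E.

Definition equivariance_defect M (g : G) (psi : M -> Y) : \bar R :=
  \int[nvol m M]_(p in [set p | act_dom M (g, p)])
     (rho (psi (act M g p)) (c g (psi p)))%:E
  + nvol m M (~` [set p | act_dom M (g, p)]).

Definition approx_maps M (L : set G) (delta : R)
    (O : set (probability (borel Y) R)) : set (M -> Y) :=
  [set psi | [/\ measurable_fun setT (psi : borel M -> borel Y),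
      forall g, L g -> equivariance_defect g psi < delta%:E &
      exists2 P, O P & forall A : set (borel Y), measurable A ->
        P A = nvol m M (psi @^-1` A)]].

(* Sup of the cardinalities of finite separated subsets; +oo if unbounded. *)
Definition sep M (eps : R) (E : set (M -> Y)) : \bar R :=
  ereal_sup [set n%:R%:E | n in [set n : nat | exists S : set (M -> Y),
    [/\ S `<=` E, (S #= `I_n)%card &
        forall psi psi', S psi -> S psi' -> psi <> psi' ->
          eps%:E < map_dist psi psi']]].

Definition entropy_at (eps : R) : \bar R :=
  ereal_inf [set
    ereal_inf [set
      ereal_inf [set
        limn_esup (fun i =>
          ((fine (vol m (Sigma i) setT))^-1)%:E *
          lne (sep eps (@approx_maps (Sigma i) L delta O)))
      | delta in [set delta : R | (0 < delta)%R]]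
    | L in [set L : set G | open_nbhs 1%g L /\ precompact L]]
  | O in nbhs (nu : weak_star Y)].

Definition measure_entropy : \bar R := lim (entropy_at eps @[eps --> (0:R)^'+]).

End Entropy.

Definition completely_positive_entropy {R : realType} {G : lcscGroupType}
    (m : {measure set (borel G) -> \bar R}) (Sigma : nat -> local_space G)
    dX (X : measurableType dX) (a : G -> X -> X) (mu : probability X R) : Prop :=
  forall dZ (Z : measurableType dZ) (b : G -> Z -> Z) (zeta : probability Z R),
    standard_pmp_action b zeta ->
  forall pi : X -> Z, factor_map a mu b zeta pi -> ~ point_mass zeta ->
  forall (Y : ptopologicalType) (c : G -> Y -> Y) (nu : probability (borel Y) R),
    compact_model b zeta c nu ->
  forall rho : Y -> Y -> R, compatible_metric rho ->
    (forall x y, rho x y <= 1) ->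
  (0 < measure_entropy m Sigma c nu rho)%E.

(* A library measure is a function on all sets, unconstrained outside the
   sigma-algebra; [config_off] selects one representative for each Borel
   measure, so that equality of configurations is equality of measures. *)
Record config (R : realType) (G : lcscGroupType) := Config {
  config_measure :> {measure set (borel G) -> \bar R};
  config_radon : radon config_measure;
  config_integer : forall A : set (borel G), measurable A ->
    config_measure A = +oo%E \/ exists n : nat, config_measure A = n%:R%:E;
  config_off : forall A : set (borel G), ~ measurable A ->
    config_measure A = 0%E }.

Section ConfigPoint.
Context {R : realType} {G : lcscGroupType}.
Local Open Scope ereal_scope.

Local Lemma mzero_radon : radon (@mzero _ (borel G) R).
Proof.
split => [K _|A _|U _]; rewrite /mzero ?ltry//.
- rewrite (_ : [set _ | _ in _] = [set 0]) ?ereal_inf1//.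
  apply/seteqP; split => [_ [? _ <-]//|_ ->].
  by exists setT => //; split => //; exact: openT.
- rewrite (_ : [set _ | _ in _] = [set 0]) ?ereal_sup1//.
  apply/seteqP; split => [_ [? _ <-]//|_ ->].
  by exists set0 => //; split => //; exact: compact0.
Qed.

Local Lemma mzero_integer (A : set (borel G)) : measurable A ->
  @mzero _ (borel G) R A = +oo \/ exists n : nat, @mzero _ (borel G) R A = n%:R%:E.
Proof. by move=> _; right; exists 0%N. Qed.

Local Lemma mzero_off (A : set (borel G)) : ~ measurable A ->
  @mzero _ (borel G) R A = 0.
Proof. by []. Qed.

HB.instance Definition _ := gen_eqMixin (config R G).
HB.instance Definition _ := gen_choiceMixin (config R G).
HB.instance Definition _ :=
  isPointed.Build (config R G) (Config mzero_radon mzero_integer mzero_off).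

End ConfigPoint.

Section Vague.
Context (R : realType) (G : lcscGroupType).

Definition Cc : Type :=
  {f : G -> R | continuous f /\ compact (closure [set x | f x != 0])}.

Definition vague_eval (w : config R G) : {ptws Cc -> R} :=
  fun f => (\int[w]_x (sval f x))%R.

(* The space N(G): configurations with the vague topology. *)
HB.instance Definition _ :=
  Topological.copy (config R G) (initial_topology vague_eval).

End Vague.

Section Translate.
Context {R : realType} {G : lcscGroupType}.
Local Open Scope ereal_scope.

Local Lemma mulgr_measurable (g : G) :
  measurable_fun [set: borel G] (fun x : borel G => (x * g)%g : borel G).
Proof.
apply: (@measurability _ _ (borel G) (borel G) _ _ (@open G)) => // _ [B oB <-].
rewrite setTI.
by apply: sub_sigma_algebra; move: B oB; apply/continuousP; exact: cst_mul_cts.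
Qed.

Variables (g : G) (w : config R G).
Let f (x : borel G) : borel G := (x * g^-1)%g.
Let h (x : borel G) : borel G := (x * g)%g.

Let fh A : f @^-1` (h @^-1` A) = A.
Proof. by apply/seteqP; split => x; rewrite /f /h/= mulgVK. Qed.

Let hf A : h @^-1` (f @^-1` A) = A.
Proof. by apply/seteqP; split => x; rewrite /f /h/= mulgK. Qed.

Let f_open (U : set G) : open U -> open (f @^-1` U).
Proof. by move: U; apply/continuousP; exact: cst_mul_cts. Qed.

Let h_open (U : set G) : open U -> open (h @^-1` U).
Proof. by move: U; apply/continuousP; exact: cst_mul_cts. Qed.

Let f_image A : f @^-1` A = h @` A.
Proof.
apply/seteqP; split => [x Ax|_ [x Ax <-]]; last by rewrite /f /h/= mulgK.
by exists (f x) => //; rewrite /f /h mulgVK.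
Qed.

Let h_image A : h @^-1` A = f @` A.
Proof.
apply/seteqP; split => [x Ax|_ [x Ax <-]]; last by rewrite /f /h/= mulgVK.
by exists (h x) => //; rewrite /f /h mulgK.
Qed.

Let f_compact (K : set G) : compact K -> compact (f @^-1` K).
Proof.
move=> cK; rewrite f_image; apply: (@continuous_compact G G) => //.
by apply: continuous_subspaceT; exact: cst_mul_cts.
Qed.

Let h_compact (K : set G) : compact K -> compact (h @^-1` K).
Proof.
move=> cK; rewrite h_image; apply: (@continuous_compact G G) => //.
by apply: continuous_subspaceT; exact: cst_mul_cts.
Qed.

Let f_measurable : measurable_fun setT f.
Proof. exact: mulgr_measurable. Qed.

Let h_measurable : measurable_fun setT h.
Proof. exact: mulgr_measurable. Qed.

Let mf A : measurable A -> measurable (f @^-1` A).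
Proof. by move=> mA; rewrite -[X in measurable X]setTI; exact: f_measurable. Qed.

Let mh A : measurable A -> measurable (h @^-1` A).
Proof. by move=> mA; rewrite -[X in measurable X]setTI; exact: h_measurable. Qed.

(* (g w)(A) = w(Ag) *)
Definition translate_measure (A : set (borel G)) : \bar R :=
  w [set (x * g)%g | x in A].

Local Lemma translate_measureE A : translate_measure A = w (f @^-1` A).
Proof. by rewrite f_image. Qed.

Let translate0 : translate_measure set0 = 0.
Proof. by rewrite translate_measureE preimage_set0 measure0. Qed.

Let translate_ge0 A : 0 <= translate_measure A.
Proof. exact: measure_ge0. Qed.

Let translate_sigma_additive : semi_sigma_additive translate_measure.
Proof.
move=> F mF tF mUF; rewrite translate_measureE.
have -> : (fun n => \sum_(0 <= i < n) translate_measure (F i)) =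
          (fun n => \sum_(0 <= i < n) w (f @^-1` F i)).
  by apply/funext => n; apply: eq_bigr => i _; rewrite translate_measureE.
rewrite preimage_bigcup.
apply: (@measure_semi_sigma_additive _ _ _ w (fun n => f @^-1` F n)).
- by move=> n; exact: mf.
- apply/trivIsetP => /= i j _ _ ij; rewrite -preimage_setI.
  by move/trivIsetP : tF => /(_ _ _ _ _ ij) ->//; rewrite preimage_set0.
- by rewrite -preimage_bigcup; exact: (mf mUF).
Qed.

HB.instance Definition _ := isMeasure.Build _ _ _ translate_measure
  translate0 translate_ge0 translate_sigma_additive.

Local Lemma translate_radon : radon translate_measure.
Proof.
have [w1 w2 w3] := config_radon w; split => /= [K cK|A mA|U oU];
  rewrite translate_measureE.
- by apply: w1; exact: f_compact.
- rewrite w2; last exact: mf.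
  congr ereal_inf; apply/seteqP; split => _ [U [oU AU] <-].
    exists (h @^-1` U); last by rewrite translate_measureE fh.
    by split; [exact: h_open | rewrite -[A]hf; exact: preimage_subset].
  exists (f @^-1` U); last by rewrite translate_measureE.
  by split; [exact: f_open | exact: preimage_subset].
- rewrite w3; last exact: f_open.
  congr ereal_sup; apply/seteqP; split => _ [K [cK KU] <-].
    exists (h @^-1` K); last by rewrite translate_measureE fh.
    by split; [exact: h_compact | rewrite -[U]hf; exact: preimage_subset].
  exists (f @^-1` K); last by rewrite translate_measureE.
  by split; [exact: f_compact | exact: preimage_subset].
Qed.

Local Lemma translate_integer (A : set (borel G)) : measurable A ->
  translate_measure A = +oo \/ exists n : nat, translate_measure A = n%:R%:E.
Proof. by move=> mA; rewrite translate_measureE; apply: config_integer; exact: mf. Qed.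

Local Lemma translate_off (A : set (borel G)) : ~ measurable A ->
  translate_measure A = 0.
Proof.
move=> mA; rewrite translate_measureE config_off// => mfA; apply: mA.
by rewrite -[A]hf; exact: mh.
Qed.

Definition translate : config R G :=
  Config translate_radon translate_integer translate_off.

End Translate.

Section PoissonProcess.
Context {R : realType}.
Local Open Scope ereal_scope.

Definition mutually_independent d (Omega : measurableType d)
    (P : probability Omega R) k (X : 'I_k -> Omega -> \bar R) : Prop :=
  forall B : 'I_k -> set (\bar R), (forall i, measurable (B i)) ->
    P (\bigcap_(i in [set: 'I_k]) (X i @^-1` B i)) =
    \prod_(i < k) P (X i @^-1` B i).

(* The second argument of poisson_prob is unused by the library. *)
Definition poisson_distributed d (Omega : measurableType d)
    (P : probability Omega R) (X : Omega -> \bar R) (rate : R) : Prop :=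
  forall U : set nat,
    P (X @^-1` [set n%:R%:E | n in U]) = poisson_prob rate 0 U.

(* eta is a Poisson point process with intensity alpha * m. *)
Definition poisson_process (G : lcscGroupType)
    (m : {measure set (borel G) -> \bar R}) (alpha : R)
    d (Omega : measurableType d) (P : probability Omega R)
    (eta : Omega -> config R G) : Prop :=
  forall k (A : 'I_k -> set (borel G)),
    (forall i, measurable (A i) /\ m (A i) < +oo) ->
    trivIset setT A ->
    mutually_independent P (fun i w => eta w (A i)) /\
    forall i, poisson_distributed P (fun w => eta w (A i))
                (alpha * fine (m (A i)))%R.

End PoissonProcess.

(* Main.v *)
(* The event that the configuration is empty is translation invariant and has
   probability exp(-alpha m(G)), strictly between 0 and 1, so it gives a factor
   onto a nontrivial coin {false, true} with the trivial action. Since G is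
   compact, L may be taken to be G itself. If psi : G -> {false, true} satisfies
   psi(gp) = psi(p) up to measure delta for every g in G, then averaging over g
   (Fubini and right invariance) shows that A = psi^-1(true) has
   mu(A) mu(~A) <= delta. For small delta this contradicts mu(A) being close to
   the mass of the coin: there are no approximate maps, and the entropy of the
   coin is -oo. *)
Require Import Defs.

Local Open Scope classical_set_scope.
Local Open Scope ring_scope.

(** * Joint measurability of multiplication and averaging over translates *)

Lemma countable_bigcup_measurable d (T : measurableType d) U (C : set U)
    (F : U -> set T) :
  countable C -> (forall i, C i -> measurable (F i)) ->
  measurable (\bigcup_(i in C) F i).
Proof.
move=> /pfcard_geP[->|[g]] mF; first by rewrite bigcup_set0.
have -> : \bigcup_(i in C) F i = \bigcup_n F (g n).
  apply/seteqP; split => [x [i Ci Fix]|x [n _ Fx]]; last first.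
    by exists (g n) => //; exact: funS.
  by have [n _ gn] := @surj _ _ _ _ g i Ci; exists n => //; rewrite gn.
by apply: bigcupT_measurable => n; apply: mF; exact: funS.
Qed.

(** Second countability writes an open set as a countable union of open boxes, so it lies in the
    product of the two Borel sigma-algebras, where Fubini is applied. *)
Lemma open_prod_measurable (S T : ptopologicalType) :
  @second_countable S -> @second_countable T ->
  forall U : set (S * T), open U -> measurable (U : set (borel S * borel T)).
Proof.
move=> [BS cBS [oBS bS]] [BT cBT [oBT bT]] U oU.
pose C := [set V : set S * set T | [/\ BS V.1, BT V.2 & V.1 `*` V.2 `<=` U]].
have -> : U = \bigcup_(V in C) (V.1 `*` V.2).
  apply/seteqP; split => [[x y] Uxy|z [V [_ _ +] /=]]; last exact.
  have [[A B] /= [nA nB] AB] : nbhs (x, y) U by exact: open_nbhs_nbhs.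
  have [A' [BA' A'x] A'A] := bS x A nA.
  have [B' [BB' B'y] B'B] := bT y B nB.
  exists (A', B'); split => //= -[a b] [/= Aa Bb]; apply: AB; split => /=.
    exact: A'A.
  exact: B'B.
apply: countable_bigcup_measurable.
  apply: sub_countable (countableX cBS cBT).
  by apply: subset_card_le => V [].
move=> V [BV1 BV2 _]; apply: (@measurableX _ _ (borel S) (borel T)).
  by apply: sub_sigma_algebra; exact: oBS.
by apply: sub_sigma_algebra; exact: oBT.
Qed.

Lemma mulg_measurable (G : lcscGroupType) :
  measurable_fun [set: borel G * borel G]
    (fun x : borel G * borel G => (x.1 * x.2)%g : borel G).
Proof.
have [_ scG _] := @lcscG G.
apply: (@measurability _ _ (borel G * borel G)%type (borel G) _ _ (@open G)) => // _ [B oB <-].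
rewrite setTI; apply: open_prod_measurable => //.
by move: B oB; apply/continuousP; exact: mulg_continuous.
Qed.

(* For fixed p the set {g | g p \in A} = A p^-1 has measure mu A, so the average
   over g of the left-hand side of the hypothesis is mu A * mu (~` A). *)
Lemma translation_overlap {R : realType} {G : lcscGroupType}
    (mu : probability (borel G) R) (A : set (borel G)) (d : \bar R) :
  (forall (g : G) (B : set (borel G)), measurable B ->
    mu [set (x * g)%g | x in B] = mu B) ->
  measurable A -> (0 <= d)%E ->
  (forall g : G, mu [set p : borel G | A (g * p)%g /\ ~ A p] <= d)%E ->
  (mu A * mu (~` A) <= d)%E.
Proof.
move=> mur mA d0 Ad.
(* The slice of [E] at g is the set bounded in the hypothesis; its slice at p is A p^-1 if p lies
   outside A, and empty otherwise. *)
pose E := (fun x : borel G * borel G => (x.1 * x.2)%g : borel G) @^-1` A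
   `&` (setT `*` ~` A).
have mE : measurable E.
  apply: measurableI.
    by rewrite -[X in measurable X]setTI; exact: (mulg_measurable G measurableT).
  by apply: measurableX => //; exact: measurableC.
have := indic_fubini_tonelli mu mu mE.
rewrite indic_fubini_tonelli_FE// indic_fubini_tonelli_GE// => FG.
have -> : (mu A * mu (~` A) = \int[mu]_y (mu \o ysection E) y)%E.
  transitivity (\int[mu]_y (mu A * (\1_(~` A) y)%:E))%E.
    rewrite ge0_integralZl//.
    - by rewrite integral_indic ?setIT//; exact: measurableC.
    - by apply/measurable_EFinP; apply: measurable_indic; exact: measurableC.
  apply: eq_integral => y _ /=; rewrite indicE.
  case: (boolP (y \in ~` A)) => yA; rewrite ?mule1 ?mule0.
    rewrite -(mur y^-1%g A mA); congr (mu _).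
    apply/seteqP; split => [_ [a Aa <-]|x]; rewrite /ysection/= inE.
      by rewrite /E /= mulgVK; split => //; split => //; rewrite inE in yA.
    by move=> [/= Axy _]; exists (x * y)%g => //; rewrite mulgK.
  rewrite (_ : ysection E y = set0) ?measure0//.
  apply/seteqP; split => // x; rewrite /ysection/= inE => -[_ [_ /= /mem_set]].
  exact/negP.
rewrite -FG; apply: (@le_trans _ _ (\int[mu]_x (cst d x))%E); last first.
  by rewrite integral_cst//= -[leRHS]mule1 lee_pmul// probability_le1.
apply: ge0_le_integral => //.
- exact: measurable_fun_xsection.
- move=> g _ /=; apply: le_trans (Ad g); rewrite le_measure ?inE//.
  + exact: measurable_xsection.
  + rewrite (_ : mkset _ = xsection E g); first exact: measurable_xsection.
    by apply/seteqP; split => p; rewrite /xsection/= inE /E/= => -[? ?]; split => //; tauto.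
  + by move=> p; rewrite /xsection/= inE /E/= => -[? [_ ?]].
Qed.

(** * Volume and Haar probability on the translation space *)

Section compact_group.
Context {R : realType} {G : lcscGroupType}.
Variable m : {measure set (borel G) -> \bar R}.
Hypothesis cptG : compact [set: G].
Hypothesis haar_m : right_haar m.

Let M := translation_space G.

(** A chart f centered at p is injective and takes the value g at g p, which forces f(x) = x p^-1 on
    its domain. Hence f(E) = E p^-1, and right invariance applies. *)
Lemma is_vol_translation_space : is_vol m (M := M) m.
Proof.
have [rm _ mr] := haar_m; split => // p D V f [_ _ [[VDf Dinj _] _ _] fV] E mE ED.
rewrite -(mr p^-1%g E mE); congr (m _); apply: eq_imagel => x Ex.
have Dx := ED x Ex; have [_ Dgp fgp] := fV (f x) (VDf x Dx).
have <- : (f x * p)%g = x by apply: Dinj; rewrite ?inE.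
by rewrite mulgK fgp.
Qed.

Lemma id_chart : @is_chart G M (1%g : G) setT setT id.
Proof.
split; [by split => //; exact: openT|by split => //; exact: openT| |].
- split.
  + by split => // x; exists x.
  + by apply: continuous_subspaceT => x; exact: cvg_id.
  + by exists id => //; apply: continuous_subspaceT => x; exact: cvg_id.
- by move=> g _; split => //=; rewrite mulg1.
Qed.

(** [vol] picks some measure satisfying [is_vol]. The identity is a chart at 1 with domain G, so
    every such measure agrees with [m] on Borel sets, whichever was picked. *)
Lemma vol_translation_space (A : set (borel G)) : measurable A ->
  vol m M A = m A.
Proof.
move=> mA; rewrite /vol; case: pselect => [ex|[]]; last first.
  by exists m; exact: is_vol_translation_space.
have [_ /(_ _ _ _ _ id_chart A mA)] := projT2 (cid ex).
by rewrite image_id => ->.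
Qed.

Lemma haar_lty : (m [set: G] < +oo)%E.
Proof. by have [[cm _ _] _ _] := haar_m; exact: cm. Qed.

Lemma haar_gt0 : (0 < m [set: G])%E.
Proof. by have [_ m0 _] := haar_m; rewrite lt0e m0/=. Qed.

Lemma good_points_translation_space : @good_points G M setT = setT.
Proof.
apply/seteqP; split => // p _; split; first by move=> g h _ _ _; split => //=; rewrite mulgA.
split => //; exists setT; first by split => //; exact: openT.
split.
- split => //; first by move=> x y _ _ /mulIg.
  by move=> x _; exists (x * p^-1)%g => //=; rewrite mulgVK.
- by apply: continuous_subspaceT; exact: Defs.cst_mul_cts.
- exists (fun x => (x * p^-1)%g); first by move=> x _ /=; rewrite mulgK.
  by apply: continuous_subspaceT; exact: Defs.cst_mul_cts.
Qed.

Lemma precompact_setT : precompact [set: G].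
Proof. by rewrite precompactE closureT. Qed.

(** Compactness makes G itself precompact, so U_i = G and eps_i = 0 serve at every index: each point
    is good because right multiplication by it is a homeomorphism of G. *)
Lemma sofic_translation_space : sofic_approximation m (fun=> M).
Proof.
exists (fun=> setT), (fun=> 0); split => //.
- by move=> _; split; [exact: openT|exact: precompact_setT].
- by rewrite bigcup_const//; exists 0%N.
- exact: cvg_cst.
- move=> _; rewrite /sofic_approx_space good_points_translation_space.
  rewrite subr0 mul1e vol_translation_space//; split => //.
    exact: haar_gt0.
  exact: haar_lty.
Qed.

(* The Dirac mass is the junk value of mnormalize when m G is 0 or infinite. *)
Definition haar_prob : probability (borel G) R :=
  mnormalize m (\d_(1%g : borel G) : probability (borel G) R).

Lemma haar_probE (A : set (borel G)) :
  haar_prob A = (m A * ((fine (m [set: G]))^-1)%:E)%E.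
Proof.
by rewrite /haar_prob/= /mnormalize gt_eqF ?haar_gt0//= lt_eqF ?haar_lty.
Qed.

Lemma nvol_translation_space (A : set (borel G)) : measurable A ->
  nvol m M A = haar_prob A.
Proof.
move=> mA.
transitivity ((fine (vol m M setT))^-1%:E * vol m M A)%E; first by [].
by rewrite !vol_translation_space// haar_probE muleC.
Qed.

Lemma haar_prob_mulgr (g : G) (A : set (borel G)) : measurable A ->
  haar_prob [set (x * g)%g | x in A] = haar_prob A.
Proof. by have [_ _ mr] := haar_m; move=> mA; rewrite !haar_probE mr. Qed.

End compact_group.

(** * The two-point space and its weak-star topology *)

Lemma continuous_borel_measurable (S T : ptopologicalType) (f : S -> T) :
  continuous f -> measurable_fun setT (f : borel S -> borel T).
Proof.
move=> /continuousP cf.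
apply: (@measurability _ _ (borel S) (borel T) _ _ (@open T)) => // _ [B oB <-].
by rewrite setTI; apply: sub_sigma_algebra; exact: cf.
Qed.

Lemma ptws_eval_continuous (U : Type) (V : topologicalType) (u : U) :
  continuous (fun h : {ptws U -> V} => h u).
Proof. exact: (@proj_continuous {classic U} (fun=> V) u). Qed.

Lemma bool_continuous (T : topologicalType) (f : bool -> T) : continuous f.
Proof. by apply/continuousP => A _; exact: discrete_open. Qed.

Lemma bool_measurable (A : set bool) : measurable (A : set (borel bool)).
Proof. by apply: sub_sigma_algebra; exact: discrete_open. Qed.

Definition bool_dist (R : realType) (x y : bool) : R := (x != y)%:R.

Lemma compatible_bool_dist (R : realType) : compatible_metric (@bool_dist R).
Proof.
split; first split.
- by move=> x y; exact: ler0n.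
- move=> x y; rewrite /bool_dist; split => [|->]; last by rewrite eqxx.
  by case: eqP => // _ /eqP; rewrite oner_eq0.
- by move=> x y; rewrite /bool_dist eq_sym.
- move=> x y z; rewrite /bool_dist -natrD ler_nat.
  by case: x; case: y; case: z.
move=> x A; split => [/nbhs_singleton Ax|[e e0]].
  exists 1 => // y; rewrite /bool_dist /=; case: eqP => [<- //|_].
  by rewrite ltxx.
move=> xA; have Ax : A x by apply: xA; rewrite /bool_dist/= eqxx.
by apply: open_nbhs_nbhs; split => //; exact: discrete_open.
Qed.

Definition true_mass {R : realType} (P : probability (borel bool) R) : R :=
  fine (P [set true]).

Lemma true_massE (R : realType) (P : probability (borel bool) R) :
  P [set true] = (true_mass P)%:E.
Proof. by rewrite fineK// fin_num_measure//; exact: bool_measurable. Qed.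

(** Since [bool] is discrete, the indicator of [true] is continuous, so the mass of [true] is one of
    the evaluations that generate the weak-star topology. *)
Lemma weak_star_true_mass_continuous (R : realType) :
  continuous (@true_mass R : weak_star bool -> R).
Proof.
pose f : {f : bool -> R | continuous f} := exist _ \1_[set true] (bool_continuous _ _).
have -> : @true_mass R = fun P => @weak_star_eval R bool P f.
  apply/funext => P; rewrite /weak_star_eval /Rintegral /true_mass/=.
  by rewrite integral_indic ?setIT//; exact: bool_measurable.
move=> P.
apply: (@continuous_comp (weak_star bool) {ptws {f : bool -> R | continuous f} -> R} R
  (@weak_star_eval R bool) (fun h => h f)).
  exact: initial_continuous.
exact: ptws_eval_continuous.
Qed.

(** * Almost invariant two-colourings of G *)

Section invariant_coin.
Context {R : realType} {G : lcscGroupType}.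
Variable m : {measure set (borel G) -> \bar R}.
Hypothesis cptG : compact [set: G].
Hypothesis haar_m : right_haar m.
Let M := translation_space G.
Let c : G -> bool -> bool := fun=> id.

(** With L = G the defect is below [delta] at every g, which is the uniform bound that
    [translation_overlap] averages. *)
Lemma approx_maps_bool (delta : R) O (psi : M -> bool) :
  approx_maps m (M := M) c (@bool_dist R) setT delta O psi ->
  exists2 P, O P & true_mass P * (1 - true_mass P) <= delta.
Proof.
move=> [mpsi psi_inv [P OP Ppsi]]; exists P => //.
pose mu := haar_prob m; pose A : set (borel G) := psi @^-1` [set true].
have mA : measurable A.
  by rewrite -[X in measurable X]setTI; apply: mpsi => //; exact: bool_measurable.
have muA : mu A = (true_mass P)%:E.
  by rewrite -true_massE Ppsi ?nvol_translation_space//; exact: bool_measurable.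
have -> : (1 - true_mass P = fine (mu (~` A))).
  by rewrite probability_setC// muA.
rewrite -lee_fin EFinM -muA fineK ?fin_num_measure//; last exact: measurableC.
apply: translation_overlap => //.
- by move=> g B mB; exact: haar_prob_mulgr.
(* [delta] is nonnegative because it exceeds the defect at the identity. *)
- apply: le_trans (ltW (psi_inv 1%g I)).
  by rewrite adde_ge0// integral_ge0// => p _; rewrite lee_fin ler0n.
move=> g; apply: le_trans (ltW (psi_inv g I)).
have mgA : measurable [set p : borel G | A (g * p)%g].
  rewrite -[X in measurable X]setTI.
  apply: (@continuous_borel_measurable G G (fun p => (g * p)%g)) => // p.
  apply: (@continuous_comp G (G * G)%type G (fun p => (g, p)) (fun x => (x.1 * x.2)%g)).
    by apply: cvg_pair; [exact: cvg_cst|exact: cvg_id].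
  exact: mulg_continuous.
pose gA : set (borel G) := [set p | A (g * p)%g].
(* For the 0-1 metric the integrand of the defect is the indicator of the symmetric difference [D],
   which contains the overlap set [gA] minus [A]. *)
pose D : set (borel G) := (gA `\` A) `|` (A `\` gA).
have mD : measurable D by apply: measurableU; exact: measurableD.
rewrite -nvol_translation_space//; last exact: measurableD.
rewrite /equivariance_defect.
rewrite (eq_integral (fun p : borel M => (\1_D p)%:E)) => [|p _]; last first.
  congr ((nat_of_bool _)%:R%:E); rewrite /D /gA /A /c; change (act M g p) with (g * p)%g.
  apply/idP/idP; rewrite in_setE/=; case: (psi p); case: (psi (g * p)%g) => //=.
  - by right.
  - by left.
  - by case; case.
  - by case; case.
rewrite (_ : [set p | act_dom M (g, p)] = setT); last by apply/seteqP; split.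
rewrite integral_indic// setIT setCT measure0 adde0 le_measure ?inE//.
  exact: measurableD.
by left.
Qed.

End invariant_coin.

Lemma sep_set0 (R : realType) (G : lcscGroupType) (m : {measure set (borel G) -> \bar R})
    (Y : ptopologicalType) (rho : Y -> Y -> R) (M : local_space G) (eps : R) :
  sep m rho eps (set0 : set (M -> Y)) = 0%E.
Proof.
rewrite /sep (_ : [set _ | _ in _] = [set 0%E]) ?ereal_sup1//.
apply/seteqP; split => [_ [n [S [+ Sn _]] <-]|_ ->] /=.
  rewrite subset0 => S0; move: Sn; rewrite S0 card_eq_sym card_eq0 => /eqP In0.
  case: n In0 => // n /seteqP[I0 _]; exact: False_ind (I0 0%N isT).
by exists 0%N => //; exists set0; split => //; rewrite II0.
Qed.

(** * Entropy of a nondegenerate coin with the trivial action *)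

Section invariant_coin_entropy.
Context {R : realType} {G : lcscGroupType}.
Variable m : {measure set (borel G) -> \bar R}.
Hypothesis cptG : compact [set: G].
Hypothesis haar_m : right_haar m.
Variable nu : probability (borel bool) R.
Hypothesis nu_gt0 : 0 < true_mass nu.
Hypothesis nu_lt1 : true_mass nu < 1.

Let M := translation_space G.
Let c : G -> bool -> bool := fun=> id.

Lemma entropy_at_invariant_coin (eps : R) :
  entropy_at m (fun=> M) c nu (@bool_dist R) eps = -oo%E.
Proof.
pose h (P : weak_star bool) : R := true_mass P * (1 - true_mass P).
have h_cont : continuous h.
  move=> P; apply: continuousM; first exact: weak_star_true_mass_continuous.
  apply: continuousB; first exact: cst_continuous.
  exact: weak_star_true_mass_continuous.
have h_gt0 : 0 < h nu by rewrite mulr_gt0// subr_gt0.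
(* An approximate map with tolerance [delta] has a distribution with h <= [delta], whereas h >
   [delta] throughout the weak-star neighborhood [O] of [nu]. *)
pose delta := h nu / 2.
have delta_lt : delta < h nu by rewrite ltr_pdivrMr// ltr_pMr// ltr1n.
pose O : set (probability (borel bool) R) := [set P | delta < h P].
have nbhsO : nbhs (nu : weak_star bool) O.
  exact: (cvgr_gt (h nu) (h_cont nu) _ delta_lt).
have maps0 : approx_maps m (M := M) c (@bool_dist R) setT delta O = set0.
  apply/seteqP; split => // psi /(approx_maps_bool _ cptG haar_m)[P].
  by rewrite /O/= /h => /lt_le_trans /[apply]; rewrite ltxx.
(* Each infimum is bounded by a single choice: this [O], L = G, this [delta]. The separation number
   is then 0 at every index, and its logarithm -oo is preserved by the factor 1/V > 0. *)
apply/eqP; rewrite -leeNy_eq; apply: ge_ereal_inf.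
eexists; first by exists O.
apply: ge_ereal_inf; eexists; first exists setT => //.
  split; last exact: precompact_setT.
  by split => //; exact: openT.
apply: ge_ereal_inf; eexists; first by exists delta => //=; rewrite divr_gt0.
rewrite maps0 sep_set0 le0_lneNy// vol_translation_space//.
rewrite gt0_muleNy ?lte_fin ?invr_gt0 ?fine_gt0 ?haar_gt0 ?haar_lty//.
by rewrite (cvg_limn_einf_sup (cvg_cst _)).2.
Qed.

Lemma measure_entropy_invariant_coin :
  measure_entropy m (fun=> M) c nu (@bool_dist R) = -oo%E.
Proof.
apply/cvg_lim => //.
rewrite (_ : entropy_at _ _ _ _ _ = cst -oo%E); first exact: cvg_cst.
by apply/funext => eps; rewrite entropy_at_invariant_coin.
Qed.

End invariant_coin_entropy.

Lemma standard_borel_bool (R : realType) : @standard_borel R _ (borel bool).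
Proof.
have [rho_metric _] := compatible_bool_dist R.
exists (@bool_dist R); split => //.
- exists (setT : set bool); first exact: countableP.
  by move=> x e e0; exists x => //; rewrite /bool_dist eqxx.
(* At radius 1 the Cauchy condition already makes u eventually constant. *)
- move=> u /(_ 1 ltr01)[N uN]; exists (u N) => e e0; exists N => i Ni.
  have := uN i N Ni (leqnn N); rewrite /bool_dist.
  by case: eqP; rewrite ?ltxx.
- congr (<<s _ >>); apply/seteqP; split => A _; last exact: discrete_open.
  move=> x Ax; exists 1 => // y; rewrite /bool_dist/=.
  by case: eqP => [<- //|_]; rewrite ltxx.
Qed.

(** * The empty configuration as an invariant event *)

Section void_factor.
Context {R : realType} {G : lcscGroupType}.
Hypothesis cptG : compact [set: G].

Definition is_void (w : config R G) : bool := w [set: G] == 0%E.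

Lemma config_lty (w : config R G) : (w [set: G] < +oo)%E.
Proof. by have [wK _ _] := config_radon w; exact: wK. Qed.

(** On a compact group the constant 1 has compact support, so the total mass is one of the
    evaluations defining the vague topology. Being void is then a closed condition. *)
Lemma is_void_measurable :
  measurable_fun setT (is_void : borel (config R G) -> borel bool).
Proof.
pose one : Cc R G := exist _ (cst 1) (conj (@cst_continuous _ _ _)
  (subclosed_compact (@closed_closure _ _) cptG (@subsetT _ _))).
have mtrue : measurable ([set w | is_void w] : set (borel (config R G))).
  have cts : continuous (fun w : config R G => vague_eval w one).
    move=> w; apply: (@continuous_comp (config R G) {ptws Cc R G -> R} R
      (@vague_eval R G) (fun h => h one)).
      exact: initial_continuous.
    exact: ptws_eval_continuous.
  have -> : [set w | is_void w] = (fun w => vague_eval w one) @^-1` [set 0].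
    apply/seteqP; split => w; rewrite /= /vague_eval /Rintegral/= integral_cst//= mul1e /is_void.
      by move=> /eqP ->.
    (* The real-valued integral would also be 0 for infinite mass; this is excluded because w is
       finite on the compact G. *)
    move=> w0; rewrite -(@fineK _ (w setT)) ?w0// ge0_fin_numE//.
    exact: config_lty.
  rewrite -[X in measurable X]setCK; apply: measurableC.
  apply: sub_sigma_algebra; apply: closed_openC.
  by apply: (continuous_closedP _).1 => //; exact: closed_eq.
move=> _ B _; rewrite setTI.
have [Bt|Bt] := pselect (B true); have [Bf|Bf] := pselect (B false).
- rewrite (_ : _ @^-1` _ = setT)//; apply/seteqP; split => // w _ /=.
  by case: (is_void w).
- rewrite (_ : _ @^-1` _ = [set w | is_void w])//.
  by apply/seteqP; split => w /=; case: (is_void w).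
- rewrite (_ : _ @^-1` _ = ~` [set w | is_void w]); first exact: measurableC.
  by apply/seteqP; split => w /=; case: (is_void w).
- rewrite (_ : _ @^-1` _ = set0)//.
  by apply/seteqP; split => w //=; case: (is_void w).
Qed.

Lemma is_void_translate (g : G) (w : config R G) :
  is_void (translate g w) = is_void w.
Proof.
rewrite /is_void/= /translate_measure (_ : [set _ | _ in _] = setT)//.
by apply/seteqP; split => // x _; exists (x * g^-1)%g => //; rewrite mulgVK.
Qed.

Variable m : {measure set (borel G) -> \bar R}.
Hypothesis haar_m : right_haar m.

Lemma poisson_void_prob (alpha : R) d (Omega : measurableType d)
    (P : probability Omega R) (eta : Omega -> config R G) :
  0 < alpha -> poisson_process m alpha P eta ->
  P [set w | is_void (eta w)] = (expR (- (alpha * fine (m [set: G]))))%:E.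
Proof.
(* Compactness makes m(G) finite, so the family whose single member is G is admissible; the void
   probability is the Poisson mass at 0. *)
move=> a0 /(_ 1%N (fun=> setT)) [].
- by move=> _; split => //; exact: haar_lty.
- by move=> i j _ _ _; rewrite (ord1 i) (ord1 j).
move=> _ /(_ ord0 [set 0%N]).
rewrite image_set1 /poisson_prob esum_set1; last first.
  by rewrite lee_fin poisson_pmf_ge0.
(* [poisson_pmf] takes its exponential form only at a positive rate. *)
rewrite /poisson_pmf mulr_gt0 ?fine_gt0 ?haar_gt0 ?haar_lty//.
rewrite expr0 fact0 invr1 !mul1r => <-.
congr (P _); apply/seteqP; split => w; rewrite /is_void /=.
  by move=> /eqP.
by move=> ->.
Qed.

End void_factor.

Lemma not_point_mass_bool (R : realType) (zeta : probability (borel bool) R) :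
  0 < true_mass zeta < 1 -> ~ point_mass zeta.
Proof.
move=> /andP[z0 z1] [z zE]; move: z0 z1.
rewrite /true_mass zE ?diracE; last exact: bool_measurable.
by case: (z \in _) => /=; rewrite ltxx.
Qed.

Theorem proposition9p1 (R : realType) (G : lcscGroupType)
    (m : {measure set (borel G) -> \bar R}) :
  compact [set: G] -> (exists g : G, g <> 1%g) -> right_haar m ->
  sofic_approximation m (fun=> translation_space G) /\
  forall (alpha : R), 0 < alpha ->
  forall (d : measure_display) (Omega : measurableType d)
    (P : probability Omega R) (eta : {mfun Omega >-> borel (config R G)}),
    poisson_process m alpha P eta ->
    ~ completely_positive_entropy (X := borel (config R G)) m (fun=> translation_space G)
        (@translate R G) (distribution P eta).
Proof.
move=> cptG _ haar_m; split; first exact: sofic_translation_space.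
move=> alpha alpha_gt0 d Omega P eta poisson_eta cpe.
have mvoid := is_void_measurable (R := R) cptG.
pose zeta : probability (borel bool) R :=
  distribution (distribution P eta) (mfun_Sub (mem_set mvoid)).
have zeta_true : true_mass zeta = expR (- (alpha * fine (m [set: G]))).
  by rewrite -[RHS]/(fine _%:E) -(poisson_void_prob cptG m haar_m _ _ _ _ _ alpha_gt0 poisson_eta).
have zeta01 : 0 < true_mass zeta < 1.
  rewrite zeta_true expR_gt0 expR_lt1 oppr_lt0 mulr_gt0// fine_gt0//.
  by rewrite haar_gt0 ?haar_lty.
have [zeta_gt0 zeta_lt1] := andP zeta01.
pose b : G -> borel bool -> borel bool := fun=> id.
have zeta_pmp : standard_pmp_action b zeta.
  split => //; first exact: standard_borel_bool.
  exact: measurable_snd.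
have void_factor : factor_map (X := borel (config R G)) (@translate R G)
    (distribution P eta) b zeta is_void.
  split => // g; apply: aeW => w /=; exact: is_void_translate.
(* With its discrete topology the coin is its own compact model, through the identity. *)
have zeta_model : compact_model (Y := bool) b zeta b zeta.
  split => //.
  - by split; [exact: bool_compact|exists (@bool_dist R); exact: compatible_bool_dist].
  - by move=> x; exact: cvg_snd.
  - exists id; split; first by split => // g; exact: aeW.
    exists setT, setT; split => //.
    + by split => //; rewrite setCT measure0.
    + by split => //; rewrite setCT measure0.
    + by split => // x _; exists x.
    + by exists id.
have dist_le1 (x y : bool) : bool_dist R x y <= 1 by rewrite lern1 leq_b1.
have := cpe _ _ _ _ zeta_pmp _ void_factor (not_point_mass_bool _ _ zeta01)
  bool b zeta zeta_model _ (compatible_bool_dist R) dist_le1.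
by rewrite measure_entropy_invariant_coin.
Qed.
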